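(* Let $\alpha\in[0,1]$ and $\rho>0$. If $f\in C^6[0,1]$ and $x\in[0,1]$, then, as $n\to\infty$ (for sufficiently large $n$), $$\overline{J}_{n,\alpha,\rho}^{M,2}(f;x)-f(x)=O\!\left(\frac{1}{n^2}\right).$$
   Context: Fix $\alpha\in[0,1]$ and $\rho>0$. For $x\in[0,1]$ let $p_{1,0,\alpha}(x)=1-x$, $p_{1,1,\alpha}(x)=x$, and for $m\ge 2$, $0\le k\le m$, $$p_{m,k,\alpha}(x)=\left[\binom{m-2}{k}(1-\alpha)x+\binom{m-2}{k-2}(1-\alpha)(1-x)+\binom{m}{k}\alpha x(1-x)\right]x^{k-1}(1-x)^{m-k-1}$$ (understood as a polynomial in $x$, with $\binom{r}{s}=0$ if $s<0$ or $s>r$); $p_{m,k,\alpha}=0$ if $k<0$ or $k>m$. Let $$\mu_{n,k}^\rho(t)=\frac{t^{k\rho}(1-t)^{(n-k)\rho}}{B(k\rho+1,(n-k)\rho+1)},\quad t\in[0,1],$$ where $B$ is the Beta function. For $n\ge3$ the second order $\alpha$-Bernstein–Păltănea operators are $$\overline{J}_{n,\alpha,\rho}^{M,2}(f;x)=\sum_{k=0}^n\overline{p}_{n,k,\alpha}^{M,2}(x)\int_0^1\mu_{n,k}^\rho(t)f(t)\,dt,$$ where $$\begin{aligned}\overline{p}_{n,k,\alpha}^{M,2}(x)={}&\left(\frac{n(\rho+1)}{2\rho}x^2-\frac{(n+2)(\rho+1)}{2\rho}x+\frac{1+2\rho}{2\rho}\right)p_{n-2,k,\alpha}(x)+\frac{n(\rho+1)}{\rho}x(1-x)\,p_{n-2,k-1,\alpha}(x)\\&+\left(\frac{n(\rho+1)}{2\rho}x^2-\frac{(n-2)(\rho+1)}{2\rho}x-\frac{1}{2\rho}\right)p_{n-2,k-2,\alpha}(x).\end{aligned}$$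 *)

(* Defs.v *)
From HB Require Import structures.
From mathcomp Require Import all_boot all_order all_algebra.
From mathcomp Require Import all_classical all_reals all_analysis.
From mathcomp Require Import zify ring.

Set Implicit Arguments.
Unset Strict Implicit.
Unset Printing Implicit Defensive.

Import Order.TTheory GRing.Theory Num.Theory.
Import numFieldNormedType.Exports.

Local Open Scope classical_set_scope.
Local Open Scope ring_scope.

(* The derivative is relative to [a, b], hence one-sided at a and at b;
   nothing is required of f outside [a, b]. *)
Definition is_derive_within (R : realType) (a b : R) (f f' : R -> R) : Prop :=
  forall x, x \in `[a, b] ->
    (f y - f x) / (y - x) @[y --> within `[a, b] x^'] --> f' x.

Fixpoint continuously_differentiable (R : realType) (m : nat) (a b : R)
    (f : R -> R) : Prop :=
  if m is m'.+1 then
    exists f', is_derive_within a b f f' /\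
      continuously_differentiable m' a b f'
  else {within `[a, b], continuous f}.

(* The library's beta_fun only takes natural number arguments. *)
Definition Beta (R : realType) (a b : R) : R :=
  \int[lebesgue_measure]_(t in `[0, 1]) (t `^ (a - 1) * (1 - t) `^ (b - 1)).

(* binomial coefficient with an integer lower index, 0 when it is negative *)
Definition binz (r : nat) (s : int) : nat :=
  if s is Posz j then 'C(r, j) else 0%N.

(* For m >= 2 the defining formula is
     [C(m-2,k) (1-alpha) x + C(m-2,k-2) (1-alpha) (1-x) + C(m,k) alpha x (1-x)]
       x^(k-1) (1-x)^(m-k-1),
   in which k-1 or m-k-1 may be -1. It is a polynomial, obtained by distributing
   the last factor: an exponent below that is truncated by nat subtraction comes
   with a vanishing binomial coefficient. See alpha_bernsteinE.
   The value at m = 0 is irrelevant. *)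
Definition alpha_bernstein (R : realType) (alpha : R) (m : nat) (k : int)
    (x : R) : R :=
  if k isn't Posz j then 0
  else if (m < j)%N then 0
  else if m == 1%N then (if j == 0%N then 1 - x else x)
  else (binz (m - 2)%N k)%:R * (1 - alpha) * x ^+ j * (1 - x) ^+ (m - j - 1)
     + (binz (m - 2) (k - 2))%:R * (1 - alpha)
         * x ^+ (j - 1) * (1 - x) ^+ (m - j)
     + (binz m k)%:R * alpha * x ^+ j * (1 - x) ^+ (m - j).

Lemma alpha_bernsteinE (R : realType) (alpha : R) (m k : nat) (x : R) :
  (2 <= m)%N -> (k <= m)%N ->
  x * (1 - x) * alpha_bernstein alpha m k x =
  ((binz (m - 2) k)%:R * (1 - alpha) * x
   + (binz (m - 2) (k%:Z - 2))%:R * (1 - alpha) * (1 - x)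
   + (binz m k)%:R * alpha * x * (1 - x)) * x ^+ k * (1 - x) ^+ (m - k).
Proof.
move=> m2 km; rewrite /alpha_bernstein ltnNge km /=.
have -> : (m == 1)%N = false by apply/eqP => m1; rewrite m1 in m2.
have A : ('C(m - 2, k))%:R * ((1 - x) * (1 - x) ^+ (m - k - 1))
       = ('C(m - 2, k))%:R * (1 - x) ^+ (m - k).
  have [lt|le] := ltnP (m - 2) k; first by rewrite bin_small // !mul0r.
  by rewrite -exprS; congr (_ * _ ^+ _); lia.
have B : (binz (m - 2) (k%:Z - 2))%:R * (x * x ^+ (k - 1))
       = (binz (m - 2) (k%:Z - 2))%:R * x ^+ k.
  case: k km {A} => [|k] km; first by rewrite /= !mul0r.
  by rewrite -exprS subn1.
move: A B; set a := _ ^+ (m - k - 1); set b := _ ^+ (m - k).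
set c := x ^+ (k - 1); set d := x ^+ k => A B.
transitivity ((1 - alpha) * x * d * ('C(m - 2, k)%:R * ((1 - x) * a))
  + (1 - alpha) * (1 - x) * b * ((binz (m - 2) (k%:Z - 2))%:R * (x * c))
  + x * (1 - x) * ('C(m, k)%:R * alpha * d * b)); first by ring.
by rewrite A B; ring.
Qed.

Definition mu_weight (R : realType) (rho : R) (n k : nat) (t : R) : R :=
  t `^ (k%:R * rho) * (1 - t) `^ ((n - k)%N%:R * rho)
  / Beta (k%:R * rho + 1) ((n - k)%N%:R * rho + 1).

Definition modified_alpha_bernstein (R : realType) (alpha rho : R)
    (n k : nat) (x : R) : R :=
  let p j := alpha_bernstein alpha (n - 2)%N j x in
  (n%:R * (rho + 1) / (2 * rho) * x ^+ 2
   - (n%:R + 2) * (rho + 1) / (2 * rho) * x + (1 + 2 * rho) / (2 * rho)) * p k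
  + n%:R * (rho + 1) / rho * x * (1 - x) * p (k%:Z - 1)
  + (n%:R * (rho + 1) / (2 * rho) * x ^+ 2
     - (n%:R - 2) * (rho + 1) / (2 * rho) * x - 1 / (2 * rho)) * p (k%:Z - 2).

(* meaningful for n >= 3 only *)
Definition bernstein_paltanea2 (R : realType) (alpha rho : R) (n : nat)
    (f : R -> R) (x : R) : R :=
  \sum_(0 <= k < n.+1) modified_alpha_bernstein alpha rho n k x
    * \int[lebesgue_measure]_(t in `[0, 1]) (mu_weight rho n k t * f t).

(* Main.v *)
Require Import Defs.
From mathcomp Require Import all_boot all_order all_algebra.
From mathcomp Require Import all_classical all_reals all_analysis.
From mathcomp Require Import ring zify.
Import Order.TTheory GRing.Theory Num.Theory.
Import numFieldNormedType.Exports.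
Local Open Scope classical_set_scope.
Local Open Scope ring_scope.

Set Implicit Arguments.
Unset Strict Implicit.
Unset Printing Implicit Defensive.

(** Write X = x(1-x), z = k - nx, and let T_r(n,k) be the r-th moment about x
of the Beta weight of index k.  Since f is C^6 on [0,1] there is an expansion
f(t) = sum_(i<6) c_i (t-x)^i + O(|t-x|^6) with c_0 = f(x), so that

  J_n(f;x) - f(x) = sum_(1<=i<6) c_i S_n[T_i] + S_n[error],

where S_n[g] is the sum of g against the signed weights p(n,k).  Everything
reduces to the size of S_n[T_i].

The weights have the form sum_(i<3) A_i(n) P(k-i), with P the positive
alpha-Bernstein weights of degree n-2 and A_i(n) = O(n).  The A_i sum to 1,
and their linear part in n is -(rho+1)/(2 rho) X (1,-2,1), a second
difference: sum_i A_i is 1, sum_i i A_i is bounded, and sum_i i^r A_i = O(n)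
for r >= 2.  A second difference lowers the degree in z by two, which
compensates the factor n; therefore, although the weights are of size n, the
moments S_n[z^b] are still O(n^(b/2)) with b/2 rounded down, exactly as for
binomial weights ([diffusive_modified]).

Integrating the derivative of t^(a+1) (1-t)^(b+1) (t-x)^r over [0,1] gives
([beta_central_rec], [paltanea_central_rec])

  (n rho + 2 + r) T_(r+1) = (rho z + (r+1)(1-2x)) T_r + r X T_(r-1).

If z counts for 1/2 and n for 1, then n^r T_r has weight at most r/2, so for
any weights with diffusive moments n^r S_n[T_r] = O(n^(r/2))
([growth_central_moment]).  For r >= 3 this yields S_n[T_r] = O(n^-2).  For
r = 1 and r = 2 it does not: there the particular values of the A_i make
S_n[T_1] = 0 and (n rho + 2)(n rho + 3) S_n[T_2] independent of n
([growth_modified_central]).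

Finally |p(n,k)| is at most K n times the sum of three shifted positive
alpha-Bernstein weights, for which the sixth moment T_6 is O(n^-3); the Taylor
error thus contributes O(n) O(n^-3), which is why six derivatives are asked
for. *)

(** * Polynomial growth of sequences *)

(** This is u = O(n^d), with the comparison sequence restricted to powers of n
so that exponents can be computed with. *)
Definition growth (R : realType) (d : nat) (u : nat -> R) : Prop :=
  exists C, \forall n \near \oo, `|u n| <= C * n%:R ^+ d.

Lemma growth_near (R : realType) (d : nat) (u v : nat -> R) :
  (\forall n \near \oo, u n = v n) -> growth d v -> growth d u.
Proof.
move=> uv [C vC]; exists C; near=> n.
have -> : u n = v n by near: n.
by near: n.
Unshelve. all: by end_near.
Qed.

Lemma growth_le (R : realType) (d e : nat) (u : nat -> R) :
  (d <= e)%N -> growth d u -> growth e u.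
Proof.
move=> de [C uC]; exists `|C|; near=> n.
apply: (@le_trans _ _ (C * n%:R ^+ d)); first by near: n.
apply: (@le_trans _ _ (`|C| * n%:R ^+ d)).
  by rewrite ler_wpM2r ?exprn_ge0 ?ler_norm.
rewrite ler_wpM2l // ler_weXn2l // ler1n.
by near: n; exists 1%N.
Unshelve. all: by end_near.
Qed.

Lemma growthD (R : realType) (d : nat) (u v : nat -> R) :
  growth d u -> growth d v -> growth d (fun n => u n + v n).
Proof.
move=> [C uC] [D vD]; exists (C + D); near=> n.
rewrite mulrDl (le_trans (ler_normD _ _)) // lerD //.
- by near: n.
- by near: n.
Unshelve. all: by end_near.
Qed.

Lemma growthM (R : realType) (d e : nat) (u v : nat -> R) :
  growth d u -> growth e v -> growth (d + e) (fun n => u n * v n).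
Proof.
move=> [C uC] [D vD]; exists (C * D); near=> n.
rewrite normrM exprD mulrACA ler_pM //.
- by near: n.
- by near: n.
Unshelve. all: by end_near.
Qed.

Lemma growth_cst (R : realType) (c : R) : growth 0 (fun=> c).
Proof. by exists `|c|; near=> n; rewrite expr0 mulr1.
Unshelve. all: by end_near. Qed.

Lemma growthZ (R : realType) (d : nat) (c : R) (u : nat -> R) :
  growth d u -> growth d (fun n => c * u n).
Proof. by move=> du; exact: (growthM (growth_cst c) du). Qed.

Lemma growth_natr (R : realType) : growth 1 (fun n => n%:R : R).
Proof. by exists 1; near=> n; rewrite mul1r expr1 normr_nat.
Unshelve. all: by end_near. Qed.

Lemma growth_sum (R : realType) (d m : nat) (u : nat -> nat -> R) :
  (forall i, (i < m)%N -> growth d (u i)) ->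
  growth d (fun n => \sum_(i < m) u i n).
Proof.
elim: m => [|m ihm] um.
  apply: (@growth_near _ _ _ (fun=> 0)).
    by near=> n; rewrite big_ord0.
  exact: growth_le (growth_cst 0).
apply: (@growth_near _ _ _ (fun n => \sum_(i < m) u i n + u m n)).
  by near=> n; rewrite big_ord_recr.
by apply: growthD; [apply: ihm => i im; apply: um; exact: ltnW|exact: um].
Unshelve. all: by end_near.
Qed.

(** Dividing a bound O(n^d) by n^(r-s) leaves a bounded sequence, since
d <= r - s; natural exponents avoid negative powers of n. *)
Lemma growth_divX (R : realType) (d r s : nat) (u : nat -> R) :
  (d + s <= r)%N -> growth d (fun n => n%:R ^+ r * u n) ->
  growth 0 (fun n => n%:R ^+ s * u n).
Proof.
move=> dsr [C uC]; exists `|C|; near=> n.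
have n0 : 0 < n%:R :> R by rewrite ltr0n; near: n; exists 1%N.
have n1 : 1 <= n%:R :> R by rewrite ler1n; near: n; exists 1%N.
rewrite expr0 mulr1 -(ler_pM2r (exprn_gt0 (r - s) n0)).
rewrite -[X in _ * X <= _](gtr0_norm (exprn_gt0 (r - s) n0)) -normrM.
rewrite mulrAC -exprD subnKC; last by lia.
apply: (@le_trans _ _ (C * n%:R ^+ d)); first by near: n.
apply: (@le_trans _ _ (`|C| * n%:R ^+ d)).
  by rewrite ler_wpM2r ?exprn_ge0 ?ler_norm // ltW.
by rewrite ler_wpM2l // ler_weXn2l //; lia.
Unshelve. all: by end_near.
Qed.

(** * Central moments of the binomial distribution *)

Definition bernstein_mean (R : realType) (x : R) (m : nat) (g : nat -> R) : R :=
  \sum_(0 <= j < m.+1) 'C(m, j)%:R * x ^+ j * (1 - x) ^+ (m - j) * g j.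

Lemma bernstein_mean0 (R : realType) (x : R) (g : nat -> R) :
  bernstein_mean x 0 g = g 0%N.
Proof. by rewrite /bernstein_mean big_nat1 bin0 !expr0 !mul1r. Qed.

(** Conditioning on one of the m+1 Bernoulli trials; this is Pascal's rule. *)
Lemma bernstein_meanS (R : realType) (x : R) (m : nat) (g : nat -> R) :
  bernstein_mean x m.+1 g =
  (1 - x) * bernstein_mean x m g + x * bernstein_mean x m (fun j => g j.+1).
Proof.
rewrite /bernstein_mean.
have E : \sum_(0 <= j < m.+2) 'C(m, j)%:R * x ^+ j * (1 - x) ^+ (m.+1 - j) * g j
   = (1 - x) * \sum_(0 <= j < m.+1) 'C(m, j)%:R * x ^+ j * (1 - x) ^+ (m - j) *
     g j.
  rewrite big_nat_recr //= bin_small // !mul0r addr0 mulr_sumr.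
  by apply: eq_big_nat => j /andP[_ jm]; rewrite subSn // exprS; ring.
rewrite -E [in RHS]big_nat_recl // [in LHS]big_nat_recl //= !bin0 mulr_sumr.
rewrite -addrA -big_split /=; congr (_ + _).
by apply: eq_big_nat => j /andP[_ jm]; rewrite binS natrD subSS exprS; ring.
Qed.

Lemma eq_bernstein_mean (R : realType) (x : R) (m : nat) (g h : nat -> R) :
  g =1 h -> bernstein_mean x m g = bernstein_mean x m h.
Proof. by move=> gh; apply: eq_big_nat => j _; rewrite gh. Qed.

Lemma bernstein_mean_sum (R : realType) (x : R) (m p : nat) (a : nat -> R)
    (g : nat -> nat -> R) :
  bernstein_mean x m (fun j => \sum_(i < p) a i * g i j) =
  \sum_(i < p) a i * bernstein_mean x m (g i).
Proof.
rewrite /bernstein_mean; under [RHS]eq_bigr do rewrite mulr_sumr.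
rewrite exchange_big /=; apply: eq_big_nat => j _; rewrite mulr_sumr.
by apply: eq_bigr => i _; ring.
Qed.

(** Moments of a convolution: the powers of a sum of two independent variables
split by the binomial theorem into products of moments. The weights w may be
signed. *)
Lemma sum_shifted_pow (R : realType) (p b : nat) (w s : nat -> R) (z : R) :
  \sum_(l < p) w l * (z + s l) ^+ b =
  \sum_(r < b.+1) ('C(b, r)%:R * \sum_(l < p) w l * s l ^+ r) * z ^+ (b - r).
Proof.
under eq_bigr do rewrite exprDn mulr_sumr.
rewrite exchange_big /=; apply: eq_bigr => r _.
rewrite mulr_sumr mulr_suml; apply: eq_bigr => l _.
by rewrite -mulr_natr; ring.
Qed.

Definition bernstein_moment (R : realType) (x : R) (b m : nat) : R :=
  bernstein_mean x m (fun j => (j%:R - m%:R * x) ^+ b).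

Lemma bernstein_momentS (R : realType) (x : R) (b m : nat) :
  bernstein_moment x b m.+1 =
  \sum_(r < b.+1) ('C(b, r)%:R * ((1 - x) * (- x) ^+ r + x * (1 - x) ^+ r))
     * bernstein_moment x (b - r) m.
Proof.
rewrite /bernstein_moment bernstein_meanS.
pose w (l : nat) := if l == 0%N then 1 - x else x.
pose s (l : nat) := if l == 0%N then - x else 1 - x.
transitivity (\sum_(l < 2) w l *
    bernstein_mean x m (fun j => ((j%:R - m%:R * x) + s l) ^+ b)).
  rewrite 2!big_ord_recl big_ord0 addr0 /w /s /=; congr (_ * _ + _ * _);
  by apply: eq_bernstein_mean => j; congr (_ ^+ _);
    rewrite -?[j.+1%:R]natr1 -[m.+1%:R]natr1; ring.
rewrite -(bernstein_mean_sum x m 2 w (fun l j => (j%:R - m%:R * x + s l) ^+ b)).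
under eq_bernstein_mean do rewrite sum_shifted_pow.
rewrite (bernstein_mean_sum x m _ (fun r => 'C(b, r)%:R * \sum_(l < 2) w l *
  s l ^+ r)
   (fun r j => (j%:R - m%:R * x) ^+ (b - r))).
by apply: eq_bigr => r _; rewrite 2!big_ord_recl big_ord0 addr0.
Qed.

Lemma bernstein_moments_le2 (R : realType) (x : R) (m : nat) :
  [/\ bernstein_moment x 0 m = 1, bernstein_moment x 1 m = 0 &
      bernstein_moment x 2 m = m%:R * (x * (1 - x))].
Proof.
elim: m => [|m [ih0 ih1 ih2]].
  by rewrite /bernstein_moment !bernstein_mean0; split; ring.
rewrite !bernstein_momentS !big_ord_recl !big_ord0 /= /bump /=
  !subnn !subSS !subn0 ih0 ih1 ih2.
rewrite !binn !bin0 bin1 -[m.+1%:R]natr1; split; ring.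
Qed.

(** In the recurrence [bernstein_momentS] the coefficient for r = 0 is 1 and
the one for r = 1 is the mean of a centred Bernoulli variable, which vanishes.
Hence each step from m to m+1 changes the b-th moment only by moments of order
at most b-2, and adding up m such changes costs a single factor m for every two
orders. *)
Lemma bernstein_moment_bound (R : realType) (x : R) (b : nat) :
  exists C, 0 <= C /\
    forall m, `|bernstein_moment x b m| <= C * m%:R ^+ b./2.
Proof.
elim/ltn_ind: b => b ih.
have [b2|b2] := ltnP b 2.
  exists 1; split=> // m.
  have [e0 e1 _] := bernstein_moments_le2 x m.
  by case: b b2 {ih} => [|[|//]] _; rewrite ?e0 ?e1 /=
    ?normr1 ?normr0 expr0 mulr1.
pose v r := 'C(b, r)%:R * ((1 - x) * (- x) ^+ r + x * (1 - x) ^+ r).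
have /choice[D DP] : forall r, exists C, 0 <= C /\ ((0 < r)%N -> forall m,
    `|bernstein_moment x (b - r) m| <= C * m%:R ^+ (b - r)./2).
  move=> [|r]; first by exists 0.
  by have [|C [C0 CP]] := ih (b - r.+1)%N; [lia|exists C].
(* C bounds the increments; the same C works for the moment itself, because
m * m^(h-1) = m^h absorbs their sum. *)
pose C := \sum_(r < b.-1) `|v r.+2| * D r.+2.
have C0 : 0 <= C.
  by apply: sumr_ge0 => r _; rewrite mulr_ge0 //; case: (DP r.+2).
exists C; split=> // m.
have b20 : (0 < b./2)%N by lia.
elim: m => [|m ihm].
  by rewrite /bernstein_moment bernstein_mean0 mul0r subr0
    !expr0n; do 2![case: eqP => ?; try lia]; rewrite normr0 mulr0.
rewrite bernstein_momentS.
have -> : b.+1 = (b.-1).+2 by lia.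
rewrite !big_ord_recl /= /bump /= !add1n subn0 bin0 bin1 -/(v 0%N) -/(v 1%N).
rewrite [X in X * bernstein_moment x b m](_ : _ = 1); last by ring.
rewrite [X in X * bernstein_moment x (b - 1) m](_ : _ = 0); last by ring.
rewrite mul1r mul0r add0r.
have m01 : 0 <= m%:R :> R by [].
apply: (@le_trans _ _ (C * m%:R ^+ b./2 + C * m.+1%:R ^+ (b./2.-1))).
  apply: (le_trans (ler_normD _ _)); apply: lerD => //.
  apply: (le_trans (ler_norm_sum _ _ _)).
  rewrite mulr_suml; apply: ler_sum => r _.
  rewrite add1n normrM -/(v r.+2) -mulrA ler_wpM2l //.
  have [D0 /(_ isT m) Dm] := DP r.+2.
  apply: (le_trans Dm); rewrite ler_wpM2l //.
  apply: (@le_trans _ _ (m.+1%:R ^+ (b - r.+2)./2)).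
    by rewrite lerXn2r ?nnegrE // ler_nat.
  by rewrite ler_weXn2l ?ler1n //; have := ltn_ord r; lia.
rewrite -mulrDr ler_wpM2l // -[in X in _ + _ <= X](prednK b20)
  -[in X in X + _](prednK b20) !exprS.
rewrite -[m.+1%:R in X in _ <= X * _]natr1 [X in _ <= X]mulrDl mul1r lerD //
  ler_wpM2l //.
by rewrite lerXn2r ?nnegrE // ler_nat.
Qed.

(** * Beta integrals and their moments about a point *)

(** The absolute value makes the power function continuous on the whole line,
the point 0 included, so that integrands on [0,1] are restrictions of
continuous functions. *)
Lemma continuous_normr_powR (R : realType) (a : R) :
  0 <= a -> continuous (fun t : R => `|t| `^ a).
Proof.
rewrite le_eqVlt => /predU1P[<-|a0] t.
  by rewrite /continuous_at powRr0; under eq_fun do rewrite powRr0;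
    exact: cvg_cst.
have [->|t0] := eqVneq t 0; last first.
  apply: (@continuous_comp _ _ _ (fun u : R => `|u|) (@powR R ^~ a)).
    exact: norm_continuous.
  apply: differentiable_continuous; apply/derivable1_diffP.
  by apply: ex_derive; apply: is_derive1_powR; rewrite normr_gt0.
rewrite /continuous_at normr0 powR0 ?gt_eqF //.
apply/cvgr0Pnorm_lt => e e0; near=> u.
rewrite ger0_norm ?powR_ge0 //.
have -> : e = (e `^ a^-1) `^ a by rewrite -powRrM mulVf ?gt_eqF // powRr1 ?ltW.
apply: gt0_ltr_powR => //; rewrite ?nnegrE ?powR_ge0 //.
near: u; apply: (cvgr0_norm_lt id) => //; exact: powR_gt0.
Unshelve. all: by end_near.
Qed.

Lemma within_continuousM (R : realType) (A : set R) (f g : R -> R) :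
  {within A, continuous f} -> {within A, continuous g} ->
  {within A, continuous (fun t => f t * g t)}.
Proof. by move=> cf cg t; apply: cvgM; [exact: cf|exact: cg]. Qed.

Definition beta_weight (R : realType) (a b t : R) : R := t `^ a * (1 - t) `^ b.

Lemma within_continuous_beta_weight (R : realType) (a b : R) (g : R -> R) :
  0 <= a -> 0 <= b -> {within `[0, 1], continuous g} ->
  {within `[0, 1], continuous (fun t => beta_weight a b t * g t)}.
Proof.
move=> a0 b0 cg.
apply: (@subspace_eq_continuous _ _ _
   (fun t : subspace (`[0, 1] : set R) => `|t : R| `^ a * `|1 - (t : R)| `^ b *
     g t)).
  move=> t; rewrite inE /= in_itv /= => /andP[t0 t1].
  by rewrite /from_subspace /= /beta_weight !ger0_norm // subr_ge0.
apply: (@within_continuousM _ _ (fun t => `|t| `^ a * `|1 - t| `^ b)) => //.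
apply: continuous_subspaceT => t.
apply: cvgM; first exact: continuous_normr_powR.
apply: (@continuous_comp _ _ _ (fun t : R => 1 - t) (fun t : R => `|t| `^ b)).
  by apply: continuousB; [exact: cvg_cst|exact: cvg_id].
exact: continuous_normr_powR.
Qed.

Lemma within_continuous_integrable (R : realType) (g : R -> R) :
  {within `[0, 1], continuous g} ->
  lebesgue_measure.-integrable (`[0, 1] : set R) (EFin \o g).
Proof. by move=> cg; apply: continuous_compact_integrable => //;
  exact: segment_compact. Qed.

(** Rounding the exponents up to integers only decreases the integrand on
[0,1], and the Beta function with integer arguments is positive. *)
Lemma Beta_gt0 (R : realType) (a b : R) :
  0 <= a -> 0 <= b -> 0 < Beta (a + 1) (b + 1).
Proof.
move=> a0 b0; rewrite /Beta !addrK.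
have [p ap] : exists p : nat, a <= p.+1%:R.
  by exists (Num.truncn a); exact/ltW/truncnS_gt.
have [q bq] : exists q : nat, b <= q.+1%:R.
  by exists (Num.truncn b); exact/ltW/truncnS_gt.
have := @beta_fun_gt0 R p.+2 q.+2; move=> /lt_le_trans; apply.
rewrite /beta_fun -Rintegral_mkcond; apply: le_Rintegral => //.
- apply: within_continuous_integrable; exact: within_continuous_XMonemX.
- apply: within_continuous_integrable.
  apply: (@subspace_eq_continuous _ _ _ (fun t => beta_weight a b t * 1)).
    by move=> t _; rewrite /from_subspace mulr1.
  apply: within_continuous_beta_weight => //.
  by apply: continuous_subspaceT => t; exact: cvg_cst.
- move=> t /=; rewrite in_itv /= => /andP[t0 t1];
  rewrite /XMonemX /unstable.onem.
  have le1 (u c : R) (r : nat) : 0 <= u <= 1 -> 0 <= c <= r.+1%:R ->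
      u ^+ r.+1 <= u `^ c.
    move=> /andP[u0 u1] /andP[c0 cr].
    have [->|un0] := eqVneq u 0; first by rewrite expr0n /= powR_ge0.
    by rewrite -powR_mulrn // ger_powR // u1 lt0r un0 u0.
  have t01 : 0 <= 1 - t by rewrite subr_ge0.
  apply: ler_pM; rewrite ?exprn_ge0 //; apply: le1;
    rewrite ?a0 ?b0 ?t0 ?t01 //=.
  by rewrite lerBlDr lerDl.
Qed.

Definition beta_central (R : realType) (a b x : R) (r : nat) : R :=
  \int[lebesgue_measure]_(t in `[0, 1]) (beta_weight a b t * (t - x) ^+ r).

Lemma continuous_central (R : realType) (x : R) (r : nat) :
  continuous (fun t : R => (t - x) ^+ r).
Proof.
move=> t; apply: (@continuous_comp _ _ _ (fun t : R => t - x)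
  (fun t : R => t ^+ r)).
  by apply: continuousB; [exact: cvg_id|exact: cvg_cst].
exact: exprn_continuous.
Qed.

(** The derivative is the weight t^a (1-t)^b times ((a+1)(1-t) - (b+1)t)(t-x)^r
+ r t(1-t)(t-x)^(r-1); the form below expands t and t(1-t) around x, with
t(1-t) = x(1-x) + (1-2x)(t-x) - (t-x)^2. *)
Lemma is_derive_beta_primitive (R : realType) (a b x t : R) (r : nat) :
  0 < t < 1 ->
  is_derive t 1 (fun u : R => `|u| `^ (a + 1) * `|1 - u| `^ (b + 1) *
    (u - x) ^+ r)
   (beta_weight a b t * ((a + 1 - (a + b + 2) * x + r%:R * (1 - 2 * x)) *
     (t - x) ^+ r
     + r%:R * (x * (1 - x)) * (t - x) ^+ r.-1
     - (a + b + 2 + r%:R) * (t - x) ^+ r.+1)).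
Proof.
move=> /andP[t0 t1].
have s0 : 0 < 1 - t by rewrite subr_gt0.
apply: (@near_eq_is_derive _ _ _ (fun u : R => u `^ (a + 1) *
  (1 - u) `^ (b + 1) * (u - x) ^+ r)).
  near=> u; rewrite !ger0_norm //.
    by rewrite subr_ge0; near: u; exact: lt_le_nbhsl.
  by near: u; exact: lt_le_nbhsr.
have d1 := @is_derive1_powR R (a + 1) t t0.
have d2 : is_derive t 1 (fun u => (1 - u) `^ (b + 1))
  (- ((b + 1) * (1 - t) `^ b)).
  have dd : is_derive t (1 : R) (cst (1 : R) - id) (0 - 1) by exact: is_deriveB.
  have := @is_derive1_comp R (@powR R ^~ (b + 1)) _ t _ _
    (is_derive1_powR (b + 1) s0) dd.
  by rewrite addrK sub0r mulrN1.
have d3' : is_derive t (1 : R) (id - cst x) (1 - 0) by exact: is_deriveB.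
have d3 : is_derive t (1 : R) (fun u : R => (u - x) ^+ r)
  (r%:R * (t - x) ^+ r.-1).
  have := is_deriveX r d3'; rewrite exprfctE /GRing.scale /= subr0 mulr1; exact.
have := is_deriveM (is_deriveM d1 d2) d3.
rewrite /GRing.scale /= addrK => d.
apply: (@is_derive_eq _ _ _ _ _ _ _ _ d).
rewrite /beta_weight mulrfctE /=.
have -> : t `^ (a + 1) = t * t `^ a.
  by rewrite powRD ?(gt_eqF t0) ?implybT // powRr1 ?ltW // mulrC.
have -> : (1 - t) `^ (b + 1) = (1 - t) * (1 - t) `^ b.
  by rewrite powRD ?(gt_eqF s0) ?implybT // powRr1 ?ltW // mulrC.
clear d d3 d3'; case: r => [|r] /=.
  by rewrite /=; ring.
rewrite !exprS; ring.
Unshelve. all: by end_near.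
Qed.

(** The primitive of [is_derive_beta_primitive] vanishes at 0 and at 1, so the
integral of its derivative is 0. For r = 0 the truncated index r-1 comes with
the factor r = 0. *)
Lemma beta_central_rec (R : realType) (a b x : R) (r : nat) :
  0 <= a -> 0 <= b ->
  (a + b + 2 + r%:R) * beta_central a b x r.+1 =
  (a + 1 - (a + b + 2) * x + r%:R * (1 - 2 * x)) * beta_central a b x r
  + r%:R * (x * (1 - x)) * beta_central a b x r.-1.
Proof.
move=> a0 b0.
have cont g : continuous g -> {within `[0, 1], continuous
  (fun t : R => beta_weight a b t * g t)}.
  by move=> cg; apply: within_continuous_beta_weight => //;
    exact: continuous_subspaceT.
have intc r' : lebesgue_measure.-integrable (`[0, 1] : set R)
    (EFin \o (fun t : R => beta_weight a b t * (t - x) ^+ r')).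
  by apply: within_continuous_integrable; apply: cont;
    exact: continuous_central.
have contZ c r' : {within `[0, 1], continuous
  (fun t : R => c * (beta_weight a b t * (t - x) ^+ r'))}.
  apply: within_continuousM; first by apply: continuous_subspaceT => ?;
    exact: cvg_cst.
  by apply: cont; exact: continuous_central.
pose F (u : R) := `|u| `^ (a + 1) * `|1 - u| `^ (b + 1) * (u - x) ^+ r.
pose f (t : R) := beta_weight a b t *
  ((a + 1 - (a + b + 2) * x + r%:R * (1 - 2 * x)) * (t - x) ^+ r
     + r%:R * (x * (1 - x)) * (t - x) ^+ r.-1
     - (a + b + 2 + r%:R) * (t - x) ^+ r.+1).
have cF : continuous F.
  move=> t; apply: cvgM; last exact: continuous_central.
  apply: cvgM; first by apply: continuous_normr_powR; rewrite addr_ge0.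
  apply: (@continuous_comp _ _ _ (fun t : R => 1 - t)
    (fun t : R => `|t| `^ (b + 1))).
    by apply: continuousB; [exact: cvg_cst|exact: cvg_id].
  by apply: continuous_normr_powR; rewrite addr_ge0.
have int0 : \int[lebesgue_measure]_(t in `[0, 1]) f t = 0.
  rewrite /Rintegral (@continuous_FTC2 _ f F) //.
  - rewrite /F subrr normr0 !powR0 ?gt_eqF ?ltr_wpDl //.
    by rewrite !mul0r mulr0 mul0r subee.
  - apply: (cont (fun t => (a + 1 - (a + b + 2) * x + r%:R * (1 - 2 * x)) *
    (t - x) ^+ r
     + r%:R * (x * (1 - x)) * (t - x) ^+ r.-1
     - (a + b + 2 + r%:R) * (t - x) ^+ r.+1)) => t.
    by apply: cvgB; [apply: cvgD|];
      (apply: cvgM; [exact: cvg_cst|exact: continuous_central]).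
  - split.
    + move=> t; rewrite in_itv => t01.
      by have := is_derive_beta_primitive a b x r t01 => -[].
    + by apply: cvg_at_right_filter; exact: cF.
    + by apply: cvg_at_left_filter; exact: cF.
  - move=> t; rewrite in_itv => t01.
    have := is_derive_beta_primitive a b x r t01.
    by move=> d; rewrite derive1E derive_val.
apply/eqP; rewrite -subr_eq0 -oppr_eq0 opprB -int0 /f; apply/eqP.
rewrite /beta_central -!RintegralZl // -RintegralD; last 3 first.
- by [].
- exact/within_continuous_integrable/contZ.
- exact/within_continuous_integrable/contZ.
rewrite -RintegralB //; last 2 first.
- exact/within_continuous_integrable/(within_continuousD (contZ _ _)
  (contZ _ _)).
- exact/within_continuous_integrable/contZ.
apply: eq_Rintegral => t _; ring.
Qed.

(** * Taylor expansion with one-sided derivatives at the endpoints *)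

Lemma is_derive_within_interior (R : realType) (a b : R) (f f' : R -> R)
  (t : R) :
  is_derive_within a b f f' -> a < t < b -> is_derive t 1 f (f' t).
Proof.
move=> df /andP[at_ tb].
have tab : t \in `[a, b] by rewrite in_itv /= !ltW.
have q : h^-1 *: (f (h *: 1 + t) - f t) @[h --> (0:R)^'] --> f' t.
  apply/cvgrPdist_lt => e e0.
  have /cvgrPdist_lt/(_ e e0) H := df t tab.
  have ht : (h *: 1 + t) @[h --> (0:R)] --> t.
    under eq_fun do rewrite /GRing.scale /= mulr1.
    have : h + t @[h --> (0:R)] --> 0 + t by apply: cvgD;
      [exact: cvg_id|exact: cvg_cst].
    by rewrite add0r.
  have H1 : \forall y \near t, y != t -> y \in `[a, b] ->
      `|f' t - (f y - f t) / (y - t)| < e by exact: H.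
  have H2 := ht _ H1.
  rewrite near_withinE; near=> h => h0.
  have H3 : h + t != t -> h + t \in `[a, b] ->
    `|f' t - (f (h + t) - f t) / (h + t - t)| < e.
    have : (fun y => y != t -> y \in `[a, b] ->
      `|f' t - (f y - f t) / (y - t)| < e) (h *: 1 + t) by near: h.
    by rewrite /GRing.scale /= mulr1.
  move: H3; rewrite addrK [_ / h]mulrC /GRing.scale /= mulr1; apply => //.
    by rewrite -subr_eq0 addrK.
  rewrite in_itv /=; apply/andP; split.
    rewrite -lerBlDr; near: h; apply: lt_le_nbhsr; by rewrite subr_lt0.
  rewrite -lerBrDr; near: h; apply: lt_le_nbhsl; by rewrite subr_gt0.
apply: DeriveDef; first by apply/cvg_ex; exists (f' t).
exact: cvg_lim q.
Unshelve. all: by end_near.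
Qed.

Lemma is_derive_within_continuous (R : realType) (a b : R) (f f' : R -> R) :
  is_derive_within a b f f' -> {within `[a, b], continuous f}.
Proof.
move=> df; apply/subspace_continuousP => x xab.
have /cvgrPdist_lt/(_ 1 ltr01) H := df x xab.
have H1 : \forall y \near x, y != x -> y \in `[a, b] ->
      `|f' x - (f y - f x) / (y - x)| < 1 by exact: H.
apply/cvgrPdist_lt => e e0.
have H2 : \forall y \near (x : R), `|x - y| <= e / (`|f' x| + 1).
  exists (e / (`|f' x| + 1)) => /=; first by rewrite divr_gt0 // ltr_wpDl.
  by move=> y /ltW.
rewrite near_withinE; near=> y => yab.
have [->|yx] := eqVneq y x; first by rewrite subrr normr0.
have q1 : `|(f y - f x) / (y - x)| < `|f' x| + 1.
  rewrite -(subKr (f' x) (_ / _)) (le_lt_trans (ler_normB _ _)) // ltrD2l.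
  by have := near H1 y; apply.
have yx0 : 0 < `|y - x| by rewrite normr_gt0 subr_eq0.
move: q1; rewrite normrM normfV ltr_pdivrMr // distrC => /lt_le_trans; apply.
rewrite mulrC -ler_pdivlMr; last by rewrite ltr_wpDl.
by rewrite distrC; near: y; exact: H2.
Unshelve. all: by end_near.
Qed.

Lemma continuously_differentiable_continuous (R : realType) (m : nat) (a b : R)
  (f : R -> R) :
  continuously_differentiable m a b f -> {within `[a, b], continuous f}.
Proof. by case: m => [|m] //= [f' [/is_derive_within_continuous]]. Qed.

(** The mean value theorem between x and t, where the bound on h' is largest at
the endpoint t. *)
Lemma derivative_power_bound (R : realType) (a b x M : R) (m : nat)
  (h h' : R -> R) :
  {within `[a, b], continuous h} ->
  (forall t, a < t < b -> is_derive t 1 h (h' t)) ->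
  (forall t, a <= t <= b -> `|h' t| <= M * `|t - x| ^+ m) ->
  a <= x <= b ->
  forall t, a <= t <= b -> `|h t - h x| <= M * `|t - x| ^+ m.+1.
Proof.
move=> ch dh bh /andP[ax xb] t /andP[at_ tb].
have step u v : a <= u -> u < v -> v <= b ->
    exists2 c, u < c < v & h v - h u = h' c * (v - u).
  move=> au uv vb.
  have [||c] := @MVT R h h' u v uv; last by rewrite in_itv; exists c.
    move=> c; rewrite in_itv /= => /andP[uc cv]; apply: dh.
    by rewrite (le_lt_trans au uc) (lt_le_trans cv vb).
  apply: continuous_subspaceW ch => c /=; rewrite !in_itv /= => /andP[uc cv].
  by rewrite (le_trans au uc) (le_trans cv vb).
have [tx|tx|->] := ltgtP t x; last by rewrite !subrr normr0 expr0n mulr0.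
- have [c /andP[c1 c2] e] := step t x at_ tx xb.
  rewrite distrC e normrM exprSr mulrA (distrC x t) ler_wpM2r //.
  have c3 : a <= c <= b by rewrite (le_trans at_ (ltW c1))
    (le_trans (ltW c2) xb).
  apply: (le_trans (bh c c3)).
  have M0 : 0 <= M.
    have := le_trans (normr_ge0 _) (bh c c3);
      rewrite pmulr_lge0 // exprn_gt0 // normr_gt0 subr_eq0.
    by rewrite lt_eqF.
  rewrite ler_wpM2l // lerXn2r ?nnegrE // ltr0_norm ?subr_lt0 // ltr0_norm
    ?subr_lt0 //.
  by rewrite lerN2 lerD2r ltW.
- have [c /andP[c1 c2] e] := step x t ax tx tb.
  rewrite e normrM exprSr mulrA ler_wpM2r //.
  have c3 : a <= c <= b by rewrite (le_trans ax (ltW c1))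
    (le_trans (ltW c2) tb).
  apply: (le_trans (bh c c3)).
  have M0 : 0 <= M.
    have := le_trans (normr_ge0 _) (bh c c3);
      rewrite pmulr_lge0 // exprn_gt0 // normr_gt0 subr_eq0.
    by rewrite gt_eqF.
  rewrite ler_wpM2l // lerXn2r ?nnegrE // gtr0_norm ?subr_gt0 // gtr0_norm
    ?subr_gt0 //.
  by rewrite lerD2r ltW.
Qed.

(** By induction on m: the expansion of f' is integrated term by term, and the
error is the increment from x to t of f minus the integrated polynomial, whose
derivative is the error for f'. *)
Lemma taylor_within (R : realType) (a b x : R) (m : nat) (f : R -> R) :
  a <= x <= b -> continuously_differentiable m a b f ->
  exists c : nat -> R, exists M : R, forall t, a <= t <= b ->
    `|f t - \sum_(i < m) c i * (t - x) ^+ i| <= M * `|t - x| ^+ m.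
Proof.
move=> xab; elim: m f => [|m ih] f.
  move=> cf; exists (fun=> 0).
  have ab : a <= b by case/andP: xab => /le_trans; apply.
  have cn : {within `[a, b], continuous (fun t => `|f t|)}.
    by move=> t; apply: cvg_norm; exact: cf.
  have [c _ cM] := EVT_max ab cn.
  exists `|f c| => t tab; rewrite big_ord0 subr0 expr0 mulr1.
  by apply: cM; rewrite in_itv.
move=> /= [f' [df /ih[c [M cM]]]].
pose c' i := if i is j.+1 then c j / j.+1%:R else f x.
exists c', M.
pose h t := f t - \sum_(i < m) c i / i.+1%:R * (t - x) ^+ i.+1.
have dp t : is_derive t (1 : R) (fun t => \sum_(i < m) c i / i.+1%:R *
  (t - x) ^+ i.+1)
    (\sum_(i < m) c i * (t - x) ^+ i).
  have -> : (fun t => \sum_(i < m) c i / i.+1%:R * (t - x) ^+ i.+1) =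
      \sum_(i < m) (fun t => c i / i.+1%:R * (t - x) ^+ i.+1).
    by apply/funext => u; rewrite fct_sumE.
  apply: is_derive_sum => i.
  have d1 : is_derive t (1 : R) (id - cst x) (1 - 0) by exact: is_deriveB.
  have := is_deriveZ (c i / i.+1%:R) (is_deriveX i.+1 d1).
  rewrite exprfctE /GRing.scale /= subr0 mulr1 => /is_derive_eq; apply.
  by rewrite mulrA divfK // pnatr_eq0.
have hx : h x = f x.
  by rewrite /h big1 ?subr0 // => i _; rewrite subrr expr0n mulr0.
move=> t tab.
have -> : f t - \sum_(i < m.+1) c' i * (t - x) ^+ i = h t - h x.
  by rewrite big_ord_recl /= mulr1 hx /h opprD addrCA addrC.
apply: (@derivative_power_bound _ a b x M m h
  (fun t => f' t - \sum_(i < m) c i * (t - x) ^+ i)) => //.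
- apply: within_continuousB; first exact: is_derive_within_continuous df.
  apply: continuous_subspaceT => u.
  by apply: differentiable_continuous; apply/derivable1_diffP; have [] := dp u.
- by move=> u uab; exact: (is_deriveB (is_derive_within_interior df uab)
  (dp u)).
Qed.

(** * Moments of the alpha-Bernstein weights *)

Definition alpha_mean (R : realType) (alpha x : R) (m : nat) (g : nat -> R) :
  R :=
  \sum_(0 <= j < m.+1) alpha_bernstein alpha m j x * g j.

(** The weights vanish outside 0..n-2, so the shifted sum loses nothing at
either end. *)
Lemma sum_alpha_bernstein_shift (R : realType) (alpha x : R) (n i : nat)
  (g : nat -> R) :
  (2 <= n)%N -> (i <= 2)%N ->
  \sum_(0 <= k < n.+1) alpha_bernstein alpha (n - 2) (k%:Z - i%:Z) x * g k =
  alpha_mean alpha x (n - 2) (fun j => g (j + i)%N).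
Proof.
move=> n2 i2; rewrite /alpha_mean.
rewrite (@big_cat_nat _ _ _ i) //=; last lia.
rewrite big_nat_cond big1 ?add0r; last first.
  move=> k /andP[/andP[_ ki] _].
  have -> : k%:Z - i%:Z = Negz (i - k).-1 by lia.
  by rewrite mul0r.
rewrite -{1}[i]add0n big_addn.
have e : (n.+1 - i = (n - 2).+1 + (2 - i))%N by lia.
rewrite (@big_cat_nat _ _ _ (n - 2).+1) //=; last by rewrite e leq_addr.
rewrite [X in _ + X]big_nat_cond [X in _ + X]big1 ?addr0; last first.
  move=> k /andP[/andP[nk _] _].
  have -> : (k + i)%N%:Z - i%:Z = k by lia.
  by rewrite /alpha_bernstein nk mul0r.
by apply: eq_big_nat => k _; rewrite PoszD addrK.
Qed.

(** The alpha-Bernstein distribution of degree m+2 is a mixture: with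
probability alpha a binomial of size m+2, otherwise a binomial of size m plus
twice a Bernoulli variable. *)
Lemma alpha_meanE (R : realType) (alpha x : R) (m : nat) (g : nat -> R) :
  alpha_mean alpha x m.+2 g =
    (1 - alpha) * ((1 - x) * bernstein_mean x m g
                   + x * bernstein_mean x m (fun j => g j.+2))
    + alpha * bernstein_mean x m.+2 g.
Proof.
rewrite /alpha_mean.
transitivity (\sum_(0 <= j < m.+3)
     (1 - alpha) * (1 - x) * ('C(m, j)%:R * x ^+ j * (1 - x) ^+ (m - j) * g j)
  + \sum_(0 <= j < m.+3)
     (binz m (j%:Z - 2))%:R * (1 - alpha) * x ^+ (j - 1) * (1 - x) ^+
       (m.+2 - j) * g j
  + \sum_(0 <= j < m.+3)
     alpha * ('C(m.+2, j)%:R * x ^+ j * (1 - x) ^+ (m.+2 - j) * g j)).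
  rewrite -!big_split /=; apply: eq_big_nat => j /andP[_ jm].
  rewrite /alpha_bernstein /= ltnNge -ltnS jm /= subn2 /=.
  have [mj|jm'] := ltnP m j.
    by rewrite bin_small // !mul0r; ring.
  have -> : (m.+2 - j - 1 = (m - j).+1)%N by lia.
  by rewrite exprS; ring.
rewrite -!mulr_sumr -/(bernstein_mean x m.+2 g); congr (_ + _).
rewrite [in RHS]mulrDr; congr (_ + _); rewrite [in RHS]mulrA.
  rewrite 2?big_nat_recr //= !bin_small // !mul0r !addr0.
  by [].
rewrite 2?big_nat_recl //= !mul0r !add0r /bernstein_mean mulr_sumr.
apply: eq_big_nat => j /andP[_ jm].
by rewrite addn1 !subSS !subn0 exprS; ring.
Qed.

(** The law of what is added to a binomial variable of size m to obtain the
alpha-Bernstein distribution of degree m+2: the mixture of twice a Bernoulli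
variable and a binomial variable of size 2. *)
Definition alpha_shift_weight (R : realType) (alpha x : R) (l : nat) : R :=
  match l with
  | 0%N => (1 - alpha) * (1 - x) + alpha * (1 - x) ^+ 2
  | 1%N => 2 * alpha * x * (1 - x)
  | _ => (1 - alpha) * x + alpha * x ^+ 2
  end.

Lemma alpha_mean_shift (R : realType) (alpha x : R) (m : nat) (g : nat -> R) :
  alpha_mean alpha x m.+2 g = \sum_(l < 3) alpha_shift_weight alpha x l *
    bernstein_mean x m (fun j => g (j + l)%N).
Proof.
rewrite alpha_meanE !bernstein_meanS !big_ord_recl big_ord0 /bump /=.
under [X in _ = _ * X + _]eq_bernstein_mean do rewrite addn0.
under [X in _ = _ + (_ * X + _)]eq_bernstein_mean do rewrite addn1.
under [X in _ = _ + (_ + (_ * X + _))]eq_bernstein_mean do rewrite addn2.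
ring.
Qed.

(** The weights have degree n-2 but the moments are taken about nx, the mean
that the operator of index n reproduces. *)
Definition alpha_moment (R : realType) (alpha x : R) (b n : nat) : R :=
  alpha_mean alpha x (n - 2) (fun j => (j%:R - n%:R * x) ^+ b).

Lemma alpha_momentE (R : realType) (alpha x : R) (b m : nat) :
  alpha_moment alpha x b (m + 4) = \sum_(r < b.+1)
    ('C(b, r)%:R * \sum_(l < 3) alpha_shift_weight alpha x l *
      (l%:R - 4 * x) ^+ r)
    * bernstein_moment x (b - r) m.
Proof.
rewrite /alpha_moment (_ : (m + 4 - 2 = m.+2)%N); last lia.
rewrite alpha_mean_shift /bernstein_moment.
rewrite -(bernstein_mean_sum x m _ (fun r => 'C(b, r)%:R *
   \sum_(l < 3) alpha_shift_weight alpha x l * (l%:R - 4 * x) ^+ r)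
   (fun r j => (j%:R - m%:R * x) ^+ (b - r))).
rewrite -(bernstein_mean_sum x m 3 _
  (fun l j => ((j + l)%N%:R - (m + 4)%N%:R * x) ^+ b)).
apply: eq_bernstein_mean => j.
rewrite -(sum_shifted_pow 3 b (alpha_shift_weight alpha x)
  (fun l => l%:R - 4 * x)).
by apply: eq_bigr => l _; congr (_ * _ ^+ _); rewrite !natrD; ring.
Qed.

(** Adding a bounded variable to a binomial one does not change the order of
magnitude of the centred moments. *)
Lemma growth_alpha_moment (R : realType) (alpha x : R) (b : nat) :
  growth b./2 (alpha_moment alpha x b).
Proof.
pose a r : R := 'C(b, r)%:R * \sum_(l < 3) alpha_shift_weight alpha x l *
  (l%:R - 4 * x) ^+ r.
apply: (@growth_near _ _ _ (fun n => \sum_(r < b.+1) a r *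
  bernstein_moment x (b - r) (n - 4))).
  near=> n; rewrite -(@subnK 4 n); last by near: n; exists 4%N.
  by rewrite alpha_momentE addnK.
apply: (growth_sum (u := fun r n => a r * bernstein_moment x (b - r) (n - 4)))
  => r rb.
apply: growthZ; apply: (@growth_le _ (b - r)./2); first lia.
have [C [C0 CP]] := bernstein_moment_bound x (b - r).
exists C; near=> n; apply: (le_trans (CP _)); rewrite ler_wpM2l //.
by rewrite lerXn2r ?nnegrE // ler_nat leq_subr.
Unshelve. all: by end_near.
Qed.

Lemma alpha_moments_le2 (R : realType) (alpha x : R) (m : nat) :
  [/\ alpha_moment alpha x 0 (m + 4) = 1,
      alpha_moment alpha x 1 (m + 4) = - (2 * x) &
      alpha_moment alpha x 2 (m + 4) =
        (m%:R + 4 - 2 * alpha) * (x * (1 - x)) + 4 * x ^+ 2].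
Proof.
have [e0 e1 e2] := bernstein_moments_le2 x m.
by rewrite !alpha_momentE !big_ord_recl !big_ord0 /= /bump /=
  ?subnn ?subSS ?subn0 e0 e1 ?e2
  !binn !bin0 bin1; split; ring.
Qed.

Lemma alpha_bernstein_ge0 (R : realType) (alpha x : R) (m : nat) (k : int) :
  0 <= alpha <= 1 -> 0 <= x <= 1 -> 0 <= alpha_bernstein alpha m k x.
Proof.
move=> /andP[a0 a1] /andP[x0 x1]; rewrite /alpha_bernstein.
have y0 : 0 <= 1 - x by rewrite subr_ge0.
have b0 : 0 <= 1 - alpha by rewrite subr_ge0.
case: k => // j; case: ifP => // _; case: ifP => _; first by case: ifP.
by rewrite !addr_ge0 // !mulr_ge0 // exprn_ge0.
Qed.

(** * Moments of the Beta kernels under diffusive weights *)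

Definition paltanea_central (R : realType) (rho x : R) (r n k : nat) : R :=
  \int[lebesgue_measure]_(t in `[0, 1]) (mu_weight rho n k t * (t - x) ^+ r).

Lemma within_continuous_mu (R : realType) (rho : R) (n k : nat) (g : R -> R) :
  0 < rho -> {within `[0, 1], continuous g} ->
  {within `[0, 1], continuous (fun t => mu_weight rho n k t * g t)}.
Proof.
move=> rho0 cg.
pose c := (Beta (k%:R * rho + 1) ((n - k)%N%:R * rho + 1))^-1.
have -> : (fun t => mu_weight rho n k t * g t) =
    (fun t => beta_weight (k%:R * rho) ((n - k)%N%:R * rho) t * (c * g t)).
  by apply/funext => t; rewrite /mu_weight /beta_weight /c; ring.
apply: within_continuous_beta_weight; rewrite ?mulr_ge0 // ?ltW //.
by apply: within_continuousM => //; apply: continuous_subspaceT => t;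
  exact: cvg_cst.
Qed.

Lemma paltanea_centralE (R : realType) (rho x : R) (r n k : nat) :
  0 < rho ->
  paltanea_central rho x r n k =
  beta_central (k%:R * rho) ((n - k)%N%:R * rho) x r
  / Beta (k%:R * rho + 1) ((n - k)%N%:R * rho + 1).
Proof.
move=> rho0; rewrite /paltanea_central /beta_central mulrC -RintegralZl //.
  by apply: eq_Rintegral => t _; rewrite /mu_weight /beta_weight; ring.
apply: within_continuous_integrable; apply: within_continuous_beta_weight.
- by rewrite mulr_ge0 // ltW.
- by rewrite mulr_ge0 // ltW.
- exact/continuous_subspaceT/continuous_central.
Qed.

Lemma paltanea_central0 (R : realType) (rho x : R) (n k : nat) :
  0 < rho -> paltanea_central rho x 0 n k = 1.
Proof.
move=> rho0; rewrite paltanea_centralE //.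
have B0 : 0 < Beta (k%:R * rho + 1) ((n - k)%N%:R * rho + 1).
  by apply: Beta_gt0; rewrite mulr_ge0 // ltW.
rewrite -[RHS](divff (lt0r_neq0 B0)); congr (_ / _).
rewrite /beta_central /Beta !addrK.
by apply: eq_Rintegral => t _; rewrite expr0 mulr1.
Qed.

(** This is [beta_central_rec] with a = k rho and b = (n-k) rho, after division
by the Beta function. *)
Lemma paltanea_central_rec (R : realType) (rho x : R) (r n k : nat) :
  0 < rho -> (k <= n)%N ->
  (n%:R * rho + 2 + r%:R) * paltanea_central rho x r.+1 n k =
  (rho * (k%:R - n%:R * x) + r.+1%:R * (1 - 2 * x)) *
    paltanea_central rho x r n k
  + r%:R * (x * (1 - x)) * paltanea_central rho x r.-1 n k.
Proof.
move=> rho0 kn; rewrite !paltanea_centralE //.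
set a := k%:R * rho; set b := (n - k)%N%:R * rho.
have ab : n%:R * rho = a + b by rewrite -mulrDl -natrD subnKC.
have a0 : 0 <= a by rewrite mulr_ge0 // ltW.
have b0 : 0 <= b by rewrite mulr_ge0 // ltW.
have -> : rho * (k%:R - n%:R * x) = a - (a + b) * x by rewrite -ab /a; ring.
by rewrite mulrA ab (beta_central_rec x r a0 b0) -natr1; ring.
Qed.

(** The weights see k - nx as a quantity of size n^(1/2), as for sums of n
independent variables; odd moments gain half a power by cancellation. The
weights may be signed. *)
Definition diffusive_moments (R : realType) (x : R) (ell : nat -> nat -> R) :
  Prop :=
  forall b, growth b./2 (fun n =>
    \sum_(0 <= k < n.+1) ell n k * (k%:R - n%:R * x) ^+ b).

(** In terms of n^r T_r, a step of [paltanea_central_rec] multiplies by k - nx,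
multiplies by a constant, or steps back twice with a factor n; none of these
exceeds half a power of n per index. The power of k - nx in the statement is
what the induction on r needs. *)
Lemma growth_central_moment (R : realType) (rho x : R) (ell : nat -> nat -> R)
  (r b : nat) :
  0 < rho -> diffusive_moments x ell ->
  growth (b + r)./2 (fun n => n%:R ^+ r * \sum_(0 <= k < n.+1)
    ell n k * ((k%:R - n%:R * x) ^+ b * paltanea_central rho x r n k)).
Proof.
move=> rho0 dm; elim/ltn_ind: r b => -[|r] ih b.
  rewrite addn0; apply: growth_near (dm b); near=> n.
  rewrite expr0 mul1r; apply: eq_big_nat => k _.
  by rewrite paltanea_central0 // mulr1.
pose u r b n := n%:R ^+ r * \sum_(0 <= k < n.+1)
    ell n k * ((k%:R - n%:R * x) ^+ b * paltanea_central rho x r n k).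
apply: (@growth_near _ _ _ (fun n => n%:R / (n%:R * rho + 2 + r%:R) *
   ((rho * u r b.+1 n + r.+1%:R * (1 - 2 * x) * u r b n)
    + r%:R * (x * (1 - x)) * (n%:R * u r.-1 b n)))).
  near=> n.
  have n0 : 0 < n%:R :> R by rewrite ltr0n; near: n; exists 1%N.
  have d0 : n%:R * rho + 2 + r%:R != 0 :> R.
    by apply: lt0r_neq0; rewrite ltr_wpDr // ltr_wpDl // mulr_ge0 // ltW.
  have e : r%:R * (n%:R * u r.-1 b n) = r%:R * (n%:R ^+ r * \sum_(0 <= k < n.+1)
     ell n k * ((k%:R - n%:R * x) ^+ b * paltanea_central rho x r.-1 n k)).
    by rewrite /u; case: (r) => [|r']; rewrite ?mul0r //= exprS !mulrA.
  pose S r' b' := \sum_(0 <= k < n.+1)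
    ell n k * ((k%:R - n%:R * x) ^+ b' * paltanea_central rho x r' n k).
  have rec : (n%:R * rho + 2 + r%:R) * S r.+1 b =
      rho * S r b.+1 + r.+1%:R * (1 - 2 * x) * S r b + r%:R * (x * (1 - x)) *
        S r.-1 b.
    rewrite /S !mulr_sumr -!big_split /=; apply: eq_big_nat => k /andP[_ kn].
    rewrite mulrCA [_ * (_ ^+ b * _)]mulrCA paltanea_central_rec // exprS; ring.
  rewrite [r%:R * _ * (n%:R * u _ _ _)]mulrAC e {e} /u -!/(S _ _).
  apply: (mulfI d0); rewrite [LHS]mulrCA rec exprS.
  by field.
rewrite -[(b + r.+1)./2]add0n; apply: growthM.
  exists rho^-1; near=> n.
  have n0 : 0 < n%:R :> R by rewrite ltr0n; near: n; exists 1%N.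
  have d0 : 0 < n%:R * rho + 2 + r%:R :> R.
    by rewrite ltr_wpDr // ltr_wpDl // mulr_ge0 // ltW.
  rewrite expr0 mulr1 ger0_norm; last by rewrite divr_ge0 // ltW.
  rewrite ler_pdivrMr // [_^-1 * _]mulrC ler_pdivlMr // -addrA lerDl.
  by rewrite addr_ge0.
apply: growthD; [apply: growthD|].
- apply: growthZ; rewrite (_ : (b + r.+1 = b.+1 + r)%N); [exact: ih|lia].
- apply: growthZ; apply: (@growth_le _ (b + r)./2); [lia|exact: ih].
- case: r ih @u => [|r] ih u.
    apply: (@growth_near _ _ _ (fun=> 0)); first by near=> n; rewrite !mul0r.
    exact: growth_le (growth_cst 0).
  apply: growthZ; rewrite (_ : (b + r.+2)./2 = 1 + (b + r)./2)%N; last lia.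
  by apply: growthM; [exact: growth_natr|exact: ih].
Unshelve. all: by end_near.
Qed.

(** * The signed weights of the operator *)

(** The factors of p_(n-2,k-i) in the weights of the operator. Their leading
part in n is a multiple of the second difference 1, -2, 1. *)
Definition difference_coef (R : realType) (rho x : R) (i n : nat) : R :=
  match i with
  | 0%N => n%:R * (rho + 1) / (2 * rho) * x ^+ 2
           - (n%:R + 2) * (rho + 1) / (2 * rho) * x + (1 + 2 * rho) / (2 * rho)
  | 1%N => n%:R * (rho + 1) / rho * x * (1 - x)
  | _ => n%:R * (rho + 1) / (2 * rho) * x ^+ 2
           - (n%:R - 2) * (rho + 1) / (2 * rho) * x - 1 / (2 * rho)
  end.

Lemma modified_alpha_bernsteinE (R : realType) (alpha rho x : R) (n k : nat) :
  modified_alpha_bernstein alpha rho n k x =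
  \sum_(i < 3) difference_coef rho x i n *
    alpha_bernstein alpha (n - 2) (k%:Z - (i : nat)%:Z) x.
Proof.
pose q (i : nat) := difference_coef rho x i n *
  alpha_bernstein alpha (n - 2) (k%:Z - i%:Z) x.
transitivity (q 0%N + q 1%N + q 2%N); first by rewrite /q subr0.
by rewrite -(big_mkord xpredT q) !big_nat_recr //= big_nil add0r.
Qed.

Lemma growth_difference_coef (R : realType) (rho x : R) (i : nat) :
  growth 1 (difference_coef rho x i).
Proof.
have lin (a b : R) u : (forall n : nat, u n = a * n%:R + b) -> growth 1 u.
  move=> uE; apply: (@growth_near _ _ _ (fun n => a * n%:R + b)).
    by near=> n.
  apply: growthD; first exact: growthZ (growth_natr R).
  exact: growth_le (growth_cst b).
case: i => [|[|i]].
- apply: (lin ((rho + 1) / (2 * rho) * x ^+ 2 - (rho + 1) / (2 * rho) * x)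
    (- (2 * (rho + 1) / (2 * rho) * x) + (1 + 2 * rho) / (2 * rho))) => n /=;
      ring.
- apply: (lin ((rho + 1) / rho * x * (1 - x)) 0) => n /=; ring.
- apply: (lin ((rho + 1) / (2 * rho) * x ^+ 2 - (rho + 1) / (2 * rho) * x)
    (2 * (rho + 1) / (2 * rho) * x - 1 / (2 * rho))) => n /=; ring.
Unshelve. all: by end_near.
Qed.

(** The second difference annihilates constants and linear functions, hence no
n in the moments of order 0 and 1. *)
Lemma difference_coef_moments (R : realType) (rho x : R) (n : nat) :
  0 < rho ->
  [/\ \sum_(i < 3) difference_coef rho x i n = 1,
      \sum_(i < 3) difference_coef rho x i n * (i : nat)%:R
        = 2 * x - (1 - 2 * x) / rho &
      \sum_(i < 3) difference_coef rho x i n * (i : nat)%:R ^+ 2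
        = - (n%:R * (x * (1 - x)) * (rho + 1) / rho) + 4 * x - 2 *
          (1 - 2 * x) / rho].
Proof.
move=> rho0; rewrite !big_ord_recl !big_ord0 /= /bump /=.
have r0 := lt0r_neq0 rho0.
by split; field.
Qed.

(** The convolution formula [sum_shifted_pow], with c as a signed law on
0, 1, 2. *)
Lemma shifted_moment (R : realType) (alpha x : R) (c : nat -> R) (b n : nat) :
  (2 <= n)%N ->
  \sum_(0 <= k < n.+1) (\sum_(i < 3) c i *
      alpha_bernstein alpha (n - 2) (k%:Z - (i : nat)%:Z) x) *
        (k%:R - n%:R * x) ^+ b
  = \sum_(r < b.+1) ('C(b, r)%:R * \sum_(i < 3) c i * (i : nat)%:R ^+ r)
     * alpha_moment alpha x (b - r) n.
Proof.
move=> n2.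
transitivity (\sum_(i < 3) c i * alpha_mean alpha x (n - 2)
    (fun j => ((j%:R - n%:R * x) + (i : nat)%:R) ^+ b)).
  under eq_bigr do rewrite mulr_suml.
  rewrite exchange_big /=; apply: eq_bigr => i _.
  under eq_bigr do rewrite -mulrA.
  rewrite -mulr_sumr; congr (_ * _).
  rewrite (@sum_alpha_bernstein_shift _ _ _ _ _
    (fun k => (k%:R - n%:R * x) ^+ b)) //.
    by apply: eq_big_nat => j _; rewrite natrD addrAC.
  by rewrite -ltnS.
rewrite /alpha_moment /alpha_mean.
under eq_bigr do rewrite mulr_sumr.
under [RHS]eq_bigr do rewrite mulr_sumr.
rewrite exchange_big [RHS]exchange_big /=; apply: eq_big_nat => j _.
under eq_bigr do rewrite mulrCA.
under [RHS]eq_bigr do rewrite mulrCA.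
rewrite -!mulr_sumr; congr (_ * _).
exact: (sum_shifted_pow 3 b c (fun i => i%:R)).
Qed.

Lemma modified_moment (R : realType) (alpha rho x : R) (b n : nat) :
  (2 <= n)%N ->
  \sum_(0 <= k < n.+1) modified_alpha_bernstein alpha rho n k x *
    (k%:R - n%:R * x) ^+ b
  = \sum_(r < b.+1) ('C(b, r)%:R * \sum_(i < 3) difference_coef rho x i n *
    (i : nat)%:R ^+ r)
     * alpha_moment alpha x (b - r) n.
Proof.
move=> n2; rewrite -(@shifted_moment _ alpha x
  (fun i => difference_coef rho x i n)) //.
by apply: eq_bigr => k _; rewrite modified_alpha_bernsteinE.
Qed.

(** Positive weights that dominate, up to a factor O(n), the signed ones. *)
Definition alpha_window (R : realType) (alpha x : R) (n k : nat) : R :=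
  \sum_(i < 3) alpha_bernstein alpha (n - 2) (k%:Z - (i : nat)%:Z) x.

Lemma diffusive_window (R : realType) (alpha x : R) :
  diffusive_moments x (alpha_window alpha x).
Proof.
move=> b.
pose a r : R := 'C(b, r)%:R * \sum_(i < 3) 1 * (i : nat)%:R ^+ r.
apply: (@growth_near _ _ _ (fun n => \sum_(r < b.+1) a r *
  alpha_moment alpha x (b - r) n)).
  near=> n; rewrite -(shifted_moment alpha x (fun=> 1)); last by near: n;
    exists 2%N.
  by apply: eq_bigr => k _; congr (_ * _); apply: eq_bigr => i _; rewrite mul1r.
apply: (growth_sum (u := fun r n => a r * alpha_moment alpha x (b - r) n)) =>
  r rb.
apply: growthZ; apply: growth_le (growth_alpha_moment alpha x (b - r)); lia.
Unshelve. all: by end_near.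
Qed.

Lemma modified_le_window (R : realType) (alpha rho x : R) :
  0 <= alpha <= 1 -> 0 <= x <= 1 ->
  exists K, \forall n \near \oo, forall k,
    `|modified_alpha_bernstein alpha rho n k x| <= K * n%:R *
      alpha_window alpha x n k.
Proof.
move=> a01 x01.
have [K0 H0] := growth_difference_coef rho x 0.
have [K1 H1] := growth_difference_coef rho x 1.
have [K2 H2] := growth_difference_coef rho x 2.
exists (Num.max K0 (Num.max K1 K2)); near=> n => k.
rewrite modified_alpha_bernsteinE mulr_sumr (le_trans (ler_norm_sum _ _ _)) //.
apply: ler_sum => i _.
have ab0 := alpha_bernstein_ge0 (n - 2) (k%:Z - (i : nat)%:Z) a01 x01.
rewrite normrM (ger0_norm ab0) ler_wpM2r //.
case: i {ab0} => -[|[|[|//]]] /= _.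
- apply: (@le_trans _ _ (K0 * n%:R ^+ 1)); first by near: n.
  by rewrite expr1 ler_wpM2r // le_max lexx.
- apply: (@le_trans _ _ (K1 * n%:R ^+ 1)); first by near: n.
  by rewrite expr1 ler_wpM2r // !le_max lexx orbT.
- apply: (@le_trans _ _ (K2 * n%:R ^+ 1)); first by near: n.
  by rewrite expr1 ler_wpM2r // !le_max lexx !orbT.
Unshelve. all: by end_near.
Qed.

(** In the convolution formula the r-th moment of the coefficients is bounded
for r < 2, and for r >= 2 it is O(n), while the remaining factor of order b - r
gives O(n^((b-r)/2)): the product is O(n^(b/2)) in both cases. *)
Lemma diffusive_modified (R : realType) (alpha rho x : R) :
  0 < rho -> diffusive_moments x (fun n k =>
    modified_alpha_bernstein alpha rho n k x).
Proof.
move=> rho0 b.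
pose a r n : R := 'C(b, r)%:R * \sum_(i < 3) difference_coef rho x i n *
  (i : nat)%:R ^+ r.
apply: (@growth_near _ _ _ (fun n => \sum_(r < b.+1) a r n *
  alpha_moment alpha x (b - r) n)).
  by near=> n; apply: modified_moment; near: n; exists 2%N.
apply: (growth_sum (u := fun r n => a r n * alpha_moment alpha x (b - r) n)) =>
  r rb.
have [r2|r2] := ltnP r 2.
  apply: (@growth_le _ (0 + (b - r)./2)); first lia.
  apply: growthM; last exact: growth_alpha_moment.
  apply: growthZ.
  case: r r2 {rb} => [|[|//]] _.
    apply: (@growth_near _ _ _ (fun=> 1)); last exact: growth_cst.
    near=> n; have [<- _ _] := difference_coef_moments x n rho0.
    by apply: eq_bigr => i _; rewrite expr0 mulr1.
  apply: (@growth_near _ _ _ (fun=> 2 * x - (1 - 2 * x) / rho));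
    last exact: growth_cst.
  near=> n; have [_ <- _] := difference_coef_moments x n rho0.
  by apply: eq_bigr => i _; rewrite expr1.
apply: (@growth_le _ (1 + (b - r)./2)); first lia.
apply: growthM; last exact: growth_alpha_moment.
apply: growthZ; apply: (growth_sum (u := fun i n => difference_coef rho x i n *
  i%:R ^+ r)) => i _.
by rewrite -[1%N]addn0; apply: growthM;
  [exact: growth_difference_coef|exact: growth_cst].
Unshelve. all: by end_near.
Qed.

Lemma modified_moments_le2 (R : realType) (alpha rho x : R) (n : nat) :
  0 < rho -> (4 <= n)%N ->
  [/\ \sum_(0 <= k < n.+1) modified_alpha_bernstein alpha rho n k x = 1,
      \sum_(0 <= k < n.+1) modified_alpha_bernstein alpha rho n k x *
        (k%:R - n%:R * x)
        = - (1 - 2 * x) / rho &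
      \sum_(0 <= k < n.+1) modified_alpha_bernstein alpha rho n k x *
        (k%:R - n%:R * x) ^+ 2
        = (4 - 2 * alpha) * (x * (1 - x)) - n%:R * (x * (1 - x)) / rho
          - 2 * (1 - 2 * x) ^+ 2 / rho].
Proof.
move=> rho0 n4; have n2 : (2 <= n)%N by lia.
have [c0 c1 c2] := difference_coef_moments x n rho0.
have [a0 a1 a2] := alpha_moments_le2 alpha x (n - 4).
have r0 := lt0r_neq0 rho0.
rewrite subnK // in a0 a1 a2.
have nE : (n - 4)%N%:R = n%:R - 4 :> R by rewrite natrB.
(* An abstract E keeps the powers of indices from being simplified when the
sums over r are written out. *)
have [E EE] : exists E : nat -> R, forall r,
    \sum_(i < 3) difference_coef rho x i n * (i : nat)%:R ^+ r = E r by eexists.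
have M b : \sum_(0 <= k < n.+1) modified_alpha_bernstein alpha rho n k x *
  (k%:R - n%:R * x) ^+ b
    = \sum_(r < b.+1) 'C(b, r)%:R * E r * alpha_moment alpha x (b - r) n.
  by rewrite modified_moment //; apply: eq_bigr => r _; rewrite EE.
have E0 : E 0%N = 1.
  by rewrite -EE -c0; apply: eq_bigr => i _; rewrite expr0 mulr1.
have E1 : E 1%N = 2 * x - (1 - 2 * x) / rho.
  by rewrite -EE -c1; apply: eq_bigr => i _; rewrite expr1.
rewrite EE in c2.
split.
- transitivity (\sum_(0 <= k < n.+1) modified_alpha_bernstein alpha rho n k x *
  (k%:R - n%:R * x) ^+ 0).
    by apply: eq_bigr => k _; rewrite expr0 mulr1.
  by rewrite M big_ord_recl big_ord0 /= E0 a0 bin0; ring.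
- transitivity (\sum_(0 <= k < n.+1) modified_alpha_bernstein alpha rho n k x *
  (k%:R - n%:R * x) ^+ 1).
    by apply: eq_bigr => k _; rewrite expr1.
  rewrite M !big_ord_recl big_ord0 /= /bump /= E0 E1 a0 a1 bin0 binn; field.
  exact: r0.
- rewrite M !big_ord_recl big_ord0 /= /bump /=
  E0 E1 c2 a0 a1 a2 bin0 bin1 binn nE; field.
  exact: r0.
Qed.

(** For r >= 3 the diffusive bound is enough. For r = 1 it would give O(n^-1),
but the sum vanishes since the operator reproduces linear functions. For r = 2,
in the scale of k, the spread nX of the alpha-Bernstein weights, the part
-nX(1 + 1/rho) that comes from the coefficients, and the variance of the Beta
kernels, about nX/rho, cancel to first order (X = x(1-x)). *)
Lemma growth_modified_central (R : realType) (alpha rho x : R) (r : nat) :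
  0 < rho -> (0 < r)%N ->
  growth 0 (fun n => n%:R ^+ 2 * \sum_(0 <= k < n.+1)
    modified_alpha_bernstein alpha rho n k x * paltanea_central rho x r n k).
Proof.
move=> rho0 rpos.
have r0 := lt0r_neq0 rho0.
have T1 n k : (k <= n)%N -> (n%:R * rho + 2) * paltanea_central rho x 1 n k =
    rho * (k%:R - n%:R * x) + (1 - 2 * x).
  move=> kn; have := paltanea_central_rec x 0 rho0 kn.
  by rewrite paltanea_central0 // addr0 => ->; ring.
have [r3|] := ltnP 2 r.
  apply: (@growth_divX _ r./2 r); first lia.
  apply: growth_near (growth_central_moment r 0 rho0
    (@diffusive_modified R alpha rho x rho0)).
  near=> n; congr (_ * _); apply: eq_big_nat => k _.
  by rewrite expr0 mul1r.
case: r rpos => [//|[|[|//]]] _ _.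
  apply: (@growth_near _ _ _ (fun=> 0)); last exact: growth_cst.
  near=> n.
  have n4 : (4 <= n)%N by near: n; exists 4%N.
  have [m0 m1 _] := modified_moments_le2 alpha x rho0 n4.
  have d0 : n%:R * rho + 2 != 0 :> R.
    by apply: lt0r_neq0; rewrite ltr_wpDl // mulr_ge0 // ltW.
  rewrite [X in _ * X](_ : _ = 0) ?mulr0 //; apply: (mulfI d0).
  transitivity (rho * \sum_(0 <= k < n.+1) modified_alpha_bernstein alpha rho n
    k x * (k%:R - n%:R * x)
    + (1 - 2 * x) * \sum_(0 <= k < n.+1) modified_alpha_bernstein alpha rho n k
      x).
    rewrite !mulr_sumr -big_split /=; apply: eq_big_nat => k /andP[_ kn].
    by rewrite mulrCA T1 //; ring.
  by rewrite m0 m1; field.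
(* With y = 1 - 2x, (n rho + 2)(n rho + 3) T_2 is the polynomial
(rho z + 2y)(rho z + y) + X (n rho + 2) in z = k - nx; kappa is its sum
against the weights, in which the terms in n cancel. *)
pose kappa := rho ^+ 2 * (4 - 2 * alpha) * (x * (1 - x)) - 2 * rho *
  (1 - 2 * x) ^+ 2
  - (1 - 2 * x) ^+ 2 + 2 * (x * (1 - x)).
exists (`|kappa| / rho ^+ 2); near=> n.
have n4 : (4 <= n)%N by near: n; exists 4%N.
have [m0 m1 m2] := modified_moments_le2 alpha x rho0 n4.
have nr0 : 0 <= n%:R * rho by rewrite mulr_ge0 // ltW.
have d0 : 0 < n%:R * rho + 2 by rewrite ltr_wpDl.
have d1 : 0 < n%:R * rho + 3 by rewrite ltr_wpDl.
set S := \sum_(_ <= _ < _) _.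
have SE : (n%:R * rho + 2) * (n%:R * rho + 3) * S = kappa.
  transitivity (rho ^+ 2 * \sum_(0 <= k < n.+1) modified_alpha_bernstein alpha
    rho n k x * (k%:R - n%:R * x) ^+ 2
    + 3 * rho * (1 - 2 * x) * \sum_(0 <= k < n.+1) modified_alpha_bernstein
      alpha rho n k x * (k%:R - n%:R * x)
    + (2 * (1 - 2 * x) ^+ 2 + x * (1 - x) * (n%:R * rho + 2))
       * \sum_(0 <= k < n.+1) modified_alpha_bernstein alpha rho n k x).
    rewrite !mulr_sumr -!big_split /=; apply: eq_big_nat => k /andP[_ kn].
    have := @paltanea_central_rec _ rho x 1 n k rho0 kn.
    rewrite paltanea_central0 // mulr1 => T2.
    have -> : (n%:R * rho + 2) * (n%:R * rho + 3) *
      (modified_alpha_bernstein alpha rho n k x * paltanea_central rho x 2 n k)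
      = modified_alpha_bernstein alpha rho n k x *
        ((n%:R * rho + 2) * ((n%:R * rho + 2 + 1) *
          paltanea_central rho x 2 n k)).
      by ring.
    rewrite T2 mulrDr [(n%:R * rho + 2) * (_ * _)]mulrCA T1 //; ring.
  by rewrite m0 m1 m2 /kappa; field.
have -> : S = kappa / ((n%:R * rho + 2) * (n%:R * rho + 3)).
  by rewrite -SE mulrC mulKf // mulf_neq0 ?gt_eqF.
rewrite expr0 mulr1 !normrM normfV mulrCA ler_wpM2l //.
rewrite normr_nat (gtr0_norm (mulr_gt0 d0 d1)).
rewrite ler_pdivrMr ?mulr_gt0 // [rho ^- 2 * _]mulrC ler_pdivlMr ?exprn_gt0 //.
by rewrite [rho ^+ 2]expr2 mulrACA ler_pM // lerDl.
Unshelve. all: by end_near.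
Qed.

(** * The Taylor remainder and the estimate *)

Lemma mu_weight_ge0 (R : realType) (rho : R) (n k : nat) (t : R) :
  0 < rho -> 0 <= mu_weight rho n k t.
Proof.
move=> rho0; rewrite /mu_weight divr_ge0 ?mulr_ge0 ?powR_ge0 //.
by apply/ltW/Beta_gt0; rewrite mulr_ge0 // ltW.
Qed.

Lemma integrable_mu (R : realType) (rho : R) (n k : nat) (g : R -> R) :
  0 < rho -> {within `[0, 1], continuous g} ->
  lebesgue_measure.-integrable (`[0, 1] : set R)
    (EFin \o (fun t => mu_weight rho n k t * g t)).
Proof.
by move=> rho0 cg; exact/within_continuous_integrable/within_continuous_mu.
Qed.

Lemma continuous_central_sum (R : realType) (x : R) (c : nat -> R) (m : nat) :
  continuous (fun t : R => \sum_(i < m) c i * (t - x) ^+ i).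
Proof.
elim: m => [|m ih] t.
  by under eq_fun do rewrite big_ord0; exact: cvg_cst.
under eq_fun do rewrite big_ord_recr /=.
apply: cvgD; first exact: ih.
by apply: cvgM; [exact: cvg_cst|exact: continuous_central].
Qed.

Lemma integral_mu_sum (R : realType) (rho x : R) (c : nat -> R) (m n k : nat) :
  0 < rho ->
  \int[lebesgue_measure]_(t in `[0, 1])
    (mu_weight rho n k t * \sum_(i < m) c i * (t - x) ^+ i)
  = \sum_(i < m) c i * paltanea_central rho x i n k.
Proof.
move=> rho0; elim: m => [|m ih].
  rewrite big_ord0; under eq_Rintegral do rewrite big_ord0 mulr0.
  by rewrite Rintegral_cst // mul0r.
rewrite big_ord_recr /= -ih /paltanea_central -RintegralZl //; last first.
  by apply: integrable_mu => //; exact/continuous_subspaceT/continuous_central.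
rewrite -RintegralD //.
- by apply: eq_Rintegral => t _; rewrite big_ord_recr /=; ring.
- by apply: integrable_mu => //; exact/continuous_subspaceT/continuous_central_sum.
- apply: within_continuous_integrable; apply: within_continuousM.
    by apply: continuous_subspaceT => t; exact: cvg_cst.
  by apply: within_continuous_mu => //;
    exact/continuous_subspaceT/continuous_central.
Qed.

(** The sixth power is even, so the error is bounded by a moment T_6, with no
absolute value left. *)
Lemma integral_mu_taylor (R : realType) (rho x M : R) (c : nat -> R)
  (f : R -> R) (n k : nat) :
  0 < rho -> {within `[0, 1], continuous f} ->
  (forall t, 0 <= t <= 1 ->
    `|f t - \sum_(i < 6) c i * (t - x) ^+ i| <= M * `|t - x| ^+ 6) ->
  `|\int[lebesgue_measure]_(t in `[0, 1]) (mu_weight rho n k t * f t)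
    - \sum_(i < 6) c i * paltanea_central rho x i n k|
  <= M * paltanea_central rho x 6 n k.
Proof.
move=> rho0 cf fM.
have cs : {within `[0, 1], continuous
  (fun t : R => \sum_(i < 6) c i * (t - x) ^+ i)}.
  exact/continuous_subspaceT/continuous_central_sum.
have c6 : {within `[0, 1], continuous (fun t : R => (t - x) ^+ 6)}.
  exact/continuous_subspaceT/continuous_central.
have cd : {within `[0, 1], continuous
  (fun t => f t - \sum_(i < 6) c i * (t - x) ^+ i)}.
  exact: within_continuousB cf cs.
rewrite -integral_mu_sum // -RintegralB //;
  [|exact: integrable_mu|exact: integrable_mu].
have cdm := @within_continuous_mu R rho n k _ rho0 cd.
rewrite (_ : \int[_]_(_ in _) _ = \int[lebesgue_measure]_(t in `[0, 1])
   (mu_weight rho n k t * (f t - \sum_(i < 6) c i * (t - x) ^+ i))); last first.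
  by apply: eq_Rintegral => t _; rewrite mulrBr.
apply: (le_trans (le_normr_Rintegral _ _)) => //.
  exact: within_continuous_integrable.
rewrite /paltanea_central -RintegralZl //; last exact: integrable_mu.
apply: le_Rintegral => //.
- apply: within_continuous_integrable => t.
  by apply: cvg_norm; exact: cdm.
- apply: within_continuous_integrable; apply: within_continuousM.
    by apply: continuous_subspaceT => t; exact: cvg_cst.
  exact: within_continuous_mu.
- move=> t /=; rewrite in_itv /= => t01.
  rewrite normrM ger0_norm ?mu_weight_ge0 // mulrCA ler_wpM2l ?mu_weight_ge0 //.
  apply: (le_trans (fM t t01)).
  by rewrite -normrX ger0_norm // exprn_even_ge0.
Qed.

Theorem theorem8 (R : realType) (alpha rho : R) (f : R -> R) (x : R) :
  0 <= alpha <= 1 -> 0 < rho ->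
  continuously_differentiable 6 0 1 f ->
  0 <= x <= 1 ->
  (fun n : nat => bernstein_paltanea2 alpha rho n f x - f x)
    =O_\oo (fun n : nat => (n%:R ^+ 2)^-1 : R).
Proof.
move=> a01 rho0 cf x01.
have cf0 := continuously_differentiable_continuous cf.
have [c [M cM]] := taylor_within x01 cf.
(* The error bound of the expansion vanishes at t = x. *)
have c0 : c 0%N = f x.
  have := cM x x01; rewrite subrr normr0 expr0n mulr0 normr_le0 subr_eq0 =>
    /eqP ->.
  by rewrite big_ord_recl big1 ?addr0 ?expr0 ?mulr1 // => i _;
    rewrite expr0n mulr0.
pose p n k := modified_alpha_bernstein alpha rho n k x.
pose T := paltanea_central rho x.
pose e n k := \int[lebesgue_measure]_(t in `[0, 1]) (mu_weight rho n k t * f t)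
    - \sum_(i < 6) c i * T i n k.
(* The weights are O(n) times the positive ones, so the decay of T_6 is needed
with one more power of n than the target n^-2. *)
have ge : growth 0 (fun n => n%:R ^+ 2 * \sum_(0 <= k < n.+1) p n k * e n k).
  have [K Kp] := modified_le_window rho a01 x01.
  have [C HC] : growth 0 (fun n => n%:R ^+ 3 *
    \sum_(0 <= k < n.+1) alpha_window alpha x n k * T 6%N n k).
    apply: (@growth_divX _ 3 6) => //.
    apply: growth_near (growth_central_moment 6 0 rho0
      (@diffusive_window R alpha x)).
    near=> n; congr (_ * _); apply: eq_big_nat => k _.
    by rewrite expr0 mul1r.
  exists (`|K * M| * C); near=> n.
  have Kn : forall k, `|p n k| <= K * n%:R *
    alpha_window alpha x n k by near: n.
  have Cn : `|n%:R ^+ 3 * \sum_(0 <= k < n.+1) alpha_window alpha x n k *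
    T 6%N n k| <= C * n%:R ^+ 0 by near: n.
  rewrite -[X in _ <= X]mulrA.
  apply: le_trans (ler_wpM2l (normr_ge0 (K * M)) Cn).
  rewrite -normrM [X in X <= _]normrM [X in X * _ <= _]ger0_norm ?exprn_ge0 //.
  apply: (@le_trans _ _ (n%:R ^+ 2 *
    \sum_(0 <= k < n.+1) (K * n%:R * alpha_window alpha x n k) *
      (M * T 6%N n k))).
    rewrite ler_wpM2l ?exprn_ge0 // (le_trans (ler_norm_sum _ _ _)) //.
    apply: ler_sum => k _; rewrite normrM ler_pM //.
    exact: integral_mu_taylor.
  rewrite (_ : _ * _ = K * M * (n%:R ^+ 3 *
    \sum_(0 <= k < n.+1) alpha_window alpha x n k * T 6%N n k)).
    exact: ler_norm.
  by rewrite !mulr_sumr; apply: eq_bigr => k _; ring.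
have gJ : growth 0 (fun n => n%:R ^+ 2 *
  (bernstein_paltanea2 alpha rho n f x - f x)).
  apply: (@growth_near _ _ _ (fun n =>
    \sum_(i < 5) c i.+1 * (n%:R ^+ 2 * \sum_(0 <= k < n.+1) p n k * T i.+1 n k)
     + n%:R ^+ 2 * \sum_(0 <= k < n.+1) p n k * e n k)).
    near=> n.
    have n4 : (4 <= n)%N by near: n; exists 4%N.
    have [m0 _ _] := modified_moments_le2 alpha x rho0 n4.
    have -> : bernstein_paltanea2 alpha rho n f x = \sum_(i < 6) c i *
      (\sum_(0 <= k < n.+1) p n k * T i n k)
       + \sum_(0 <= k < n.+1) p n k * e n k.
      under [X in X + _]eq_bigr do rewrite mulr_sumr.
      rewrite exchange_big -big_split /=; apply: eq_big_nat => k _.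
      under [X in X + _]eq_bigr do rewrite mulrCA.
      by rewrite -mulr_sumr -mulrDr /e addrC subrK.
    rewrite big_ord_recl /= (_ : \sum_(0 <= k < n.+1) p n k * T 0%N n k = 1);
      last first.
      by rewrite -m0; apply: eq_big_nat => k _;
        rewrite /T paltanea_central0 // mulr1.
    rewrite c0 mulr1 addrAC [f x + _]addrC addrK mulrDr; congr (_ + _).
    by rewrite mulr_sumr; apply: eq_bigr => i _; rewrite mulrCA.
  apply: growthD => //.
  apply: (growth_sum (u := fun i n => c i.+1 *
    (n%:R ^+ 2 * \sum_(0 <= k < n.+1) p n k * T i.+1 n k))) => i _.
  by apply: growthZ; exact: growth_modified_central.
have [C HC] := gJ.
apply/eqO_exP; exists (`|C| + 1); first by rewrite ltr_wpDl.
near=> n.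
have n0 : 0 < n%:R ^+ 2 :> R by rewrite exprn_gt0 // ltr0n; near: n; exists 1%N.
have Cn : `|n%:R ^+ 2 * (bernstein_paltanea2 alpha rho n f x - f x)| <= C *
  n%:R ^+ 0 by near: n.
rewrite normfV (gtr0_norm n0) ler_pdivlMr // mulrC.
rewrite -[X in X * _ <= _](gtr0_norm n0) -normrM (le_trans Cn) // expr0 mulr1.
by rewrite (le_trans (ler_norm C)) // lerDl.
Unshelve. all: by end_near.
Qed.
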